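(* Let $\mathcal{X}^1,\dots,\mathcal{X}^M$ be discrete (countable) spaces and let $\pi=e^{-f}\in\mathcal{P}(\times_{i=1}^M\mathcal{X}^i)$. Let $\mu_\star=\mu_\star^1\otimes\dots\otimes\mu_\star^M$ satisfy $\mu_\star^i=\mu_\star^i[\mu_\star^{-i}]$ for all $i$, and write $B_{\varepsilon}(\mu_\star^i)=\{\mu^i\in\mathcal{P}(\mathcal{X}^i):\mathsf{TV}(\mu^i,\mu_\star^i)<\varepsilon\}$. Assume: (i) for all $i$, the optimality map $\mu_\star^i[\cdot]$ is discretely Fisher-smooth with constants $L_{ij}$ on $\times_{j\ne i}B_{\varepsilon_j}(\mu_\star^j)$; (ii) for all $i$, $\mu_\star^i$ satisfies a discrete transportation-information inequality with constant $\lambda_i$. Define $R\in\mathbb{R}^{M\times M}$ by $R_{ij}=L_{ij}/\lambda_i$ for $i\ne j$ and $R_{ii}=0$. Suppose $\rho(R)<1$, let $\delta\in(0,\infty)^M$ be such that $R\delta\prec\delta$, and let $c>0$ be such that $c\,\delta_i\le\varepsilon_i$ for all $i$. Then, whenever $\mu_k\in\times_{i=1}^MB_{c\delta_i}(\mu_\star^i)$: 1. The parallel CAVI algorithm $\mu_{k+1}^i=\mu_\star^i[\mu_k^{-i}]$, $i=1,\dots,M$, satisfies $T_{k+1}\preceq R\,T_k$. In particular $\mu_{k+1}\in\times_{i=1}^MB_{c\delta_i}(\mu_\star^i)$, and it converges exponentially fast to $\mu_\star$ in total variation distance with rate $\rho(R)$. 2. The random-scan CAVI algorithm ($I\sim\mathrm{Unif}(\{1,\dots,M\})$,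 $\mu_{k+1}^I=\mu_\star^I[\mu_k^{-I}]$, $\mu_{k+1}^{j}=\mu_k^{j}$ for $j\ne I$) satisfies $\mathbb{E}[T_{k+1}]\preceq\left(\frac1MR+\frac{M-1}{M}I_M\right)T_k$. In particular $\mu_{k+1}\in\times_{i=1}^MB_{c\delta_i}(\mu_\star^i)$, and it converges exponentially fast to $\mu_\star$ in expected total variation distance with rate $\rho\left(\frac1MR+\frac{M-1}{M}I_M\right)$. 3. Writing $R=R_L+R_U$ with $R_L,R_U$ the lower and upper triangular parts of $R$, the sequential CAVI algorithm $\mu_{k+1}^i=\mu_\star^i[\mu_{k+1}^{<i},\mu_k^{>i}]$, $i=1,\dots,M$, satisfies $T_{k+1}\preceq(I_M-R_L)^{-1}R_U\,T_k$. In particular $\mu_{k+1}\in\times_{i=1}^MB_{c\delta_i}(\mu_\star^i)$, and it converges exponentially fast to $\mu_\star$ in total variation distance with rate $\rho\left((I_M-R_L)^{-1}R_U\right)$.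
   Context: $\mathcal{P}(\mathcal{X})$ is the set of probability measures on the discrete space $\mathcal{X}$, identified with probability mass functions. $\mathsf{TV}(\varrho,\gamma)=\frac12\sum_x|\varrho(x)-\gamma(x)|$. Oscillation: $\mathrm{osc}(h)=\sup\{h(x)-h(x'):x,x'\in\mathcal{X}\}$. Optimality maps: for $\mu^{-i}=(\mu^j)_{j\ne i}$, $\mu_\star^i[\mu^{-i}](x_i)\propto\exp\left(-\mathbb{E}_{\bigotimes_{j\ne i}\mu^j}[f(X^{<i},x_i,X^{>i})]\right)$, with $X^{<i}=(X^1,\dots,X^{i-1})$, $X^{>i}=(X^{i+1},\dots,X^M)$ (similarly $\mu^{<i},\mu^{>i}$); the maps are assumed to be well defined at the measures to which they are applied. $\mu_k=(\mu_k^1,\dots,\mu_k^M)$ denotes the tuple of CAVI iterates (product measure $\mu_k^1\otimes\dots\otimes\mu_k^M$). Discrete transportation-information inequality: $\gamma\in\mathcal{P}(\mathcal{X})$ satisfies it with constant $\lambda>0$ if $\lambda\,\mathsf{TV}(\mu,\gamma)\le\mathrm{osc}\left(\log\frac{d\mu}{d\gamma}\right)$ for all $\mu\ll\gamma$. Discrete Fisher-smoothness: $\mu_\star^i[\cdot]$ is discretely Fisher-smooth with constants $L_{ij}\ge0$ on $\times_{j\ne i}B_{\varepsilon_j}(\mu_\star^j)$ if $\mathrm{osc}\left(\log\frac{d\mu_\star^i[\mu^{-i}]}{d\mu_\star^i[\mu_\star^{-i}]}\right)\le\sum_{j\ne i}L_{ij}\,\mathsf{TV}(\mu^j,\mu_\star^j)$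 for all $\mu^j\in B_{\varepsilon_j}(\mu_\star^j)$, $j\ne i$. $T_k=(\mathsf{TV}(\mu_k^1,\mu_\star^1),\dots,\mathsf{TV}(\mu_k^M,\mu_\star^M))^\top$; $\rho(\cdot)$ is the spectral radius; $\preceq,\prec$ are entrywise inequalities ($\prec$ strict in every entry); the expectation in item 2 is over the index $I$ (independent across iterations). ''Converges exponentially fast with rate $\rho(A)$'' means that the one-step bound iterates, $T_{k+m}\preceq A^mT_k$ (in expectation for the random scan) for all $m\ge0$, so that the $\limsup$ of the $m$-th root of the norm of the (expected) error vector is at most $\rho(A)<1$. *)

(* Defs.v *)
From HB Require Import structures.
From mathcomp Require Import all_boot all_order all_algebra finmap.
From mathcomp Require Import complex.
From mathcomp Require Import all_classical all_reals all_analysis.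

Set Implicit Arguments.
Unset Strict Implicit.
Unset Printing Implicit Defensive.

Import Order.TTheory GRing.Theory Num.Theory.

Local Open Scope classical_set_scope.
Local Open Scope ring_scope.

Section Discrete.
Context {R : realType} {T : countType}.
Implicit Types (p q gamma : T -> R).

Definition is_pmf p : Prop :=
  (forall x, 0 <= p x) /\ (\esum_(x in [set: T]) (p x)%:E = 1)%E.

(* The sum is at most 2 when [p] and [q] are mass functions, so [fine] is
   harmless there. *)
Definition tv p q : R :=
  2^-1 * fine (\esum_(x in [set: T]) (`|p x - q x|)%:E)%E.

Definition tv_ball (eps : R) gamma : set (T -> R) :=
  [set p | is_pmf p /\ tv p gamma < eps].

Definition dominated p gamma : Prop := forall x, gamma x = 0 -> p x = 0.

(* [h] may take the value -oo; as (-oo) - (-oo) = -oo here, pairs of points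
   where [h] is -oo do not contribute to the supremum. *)
Definition osc (D : set T) (h : T -> \bar R) : \bar R :=
  ereal_sup [set (h x - h x')%E | x in D & x' in D].

Definition log_density p gamma (x : T) : \bar R := lne (p x / gamma x)%:E.

(* For [p] dominated by [gamma] the density is determined only
   [gamma]-almost everywhere, i.e. on the support of [gamma]. *)
Definition osc_log_density p gamma : \bar R :=
  osc [set x | 0 < gamma x] (log_density p gamma).

Definition transport_information (lambda : R) gamma : Prop :=
  0 < lambda /\
  forall p, is_pmf p -> dominated p gamma ->
    ((lambda * tv p gamma)%:E <= osc_log_density p gamma)%E.

End Discrete.

Section Cavi.
Context {R : realType} {M : nat} {X : 'I_M -> countType}.

Definition config : countType := {dffun forall i : 'I_M, X i}.

Definition marginals : Type := forall i : 'I_M, X i -> R.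

Implicit Types (f : config -> \bar R) (mu nu mustar : marginals) (i : 'I_M).

(* E[f(X^{<i}, x, X^{>i})] with X^j ~ mu^j independent, j <> i: the points of
   the product of the X j, j <> i, are represented by the y with y i = x.
   The sum is meaningful for f >= 0, which holds as soon as e^{-f} is a mass
   function; [mu i] is not used. *)
Definition slice_mean f i mu (x : X i) : \bar R :=
  (\esum_(y in [set y : config | y i = x])
      ((\prod_(j < M | j != i) mu j (y j))%:E * f y))%E.

Definition opt_weight f i mu (x : X i) : \bar R :=
  expeR (- slice_mean f mu x)%E.

Definition opt_mass f i mu : \bar R :=
  (\esum_(x in [set: X i]) opt_weight f mu x)%E.

Definition opt_defined f i mu : Prop :=
  (0 < opt_mass f i mu)%E /\ (opt_mass f i mu < +oo)%E.

Definition opt_map f i mu : X i -> R :=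
  fun x => fine (opt_weight f mu x) / fine (opt_mass f i mu).

Arguments opt_map f i mu : clear implicits.

(* mu i = opt_map f i nu, where the right-hand side must be well defined. *)
Definition is_opt f i mu nu : Prop :=
  opt_defined f i nu /\ mu i = opt_map f i nu.

(* The existence of the density d mu_star^i[mu] / d mu_star^i[mu_star] is part
   of the condition. *)
Definition fisher_smooth f mustar (eps : 'I_M -> R) (L : 'I_M -> R) i : Prop :=
  (forall j, j != i -> 0 <= L j) /\
  forall mu,
    (forall j, j != i -> tv_ball (eps j) (mustar j) (mu j)) ->
    opt_defined f i mu ->
    dominated (opt_map f i mu) (opt_map f i mustar) /\
    (osc_log_density (opt_map f i mu) (opt_map f i mustar)
       <= (\sum_(j < M | j != i) L j * tv (mu j) (mustar j))%:E)%E.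

Definition tv_vec mustar mu : 'cV[R]_M := \col_i tv (mu i) (mustar i).

Definition in_balls mustar (r : 'cV[R]_M) mu : Prop :=
  forall i, tv_ball (r i 0) (mustar i) (mu i).

Definition parallel_step f mu mu' : Prop := forall i, is_opt f i mu' mu.

Definition random_scan_step f (I : 'I_M) mu mu' : Prop :=
  is_opt f I mu' mu /\ forall j, j != I -> mu' j = mu j.

Definition splice i mu' mu : marginals :=
  fun j => if (j < i)%N then mu' j else mu j.

Definition sequential_step f mu mu' : Prop :=
  forall i, is_opt f i mu' (splice i mu' mu).

End Cavi.

Section RandomIndex.
Local Open Scope ereal_scope.
Context {R : realType} {d : measure_display} {Omega : measurableType d}.
Context {M : nat}.
Implicit Type P : probability Omega R.

Definition uniform_index P (I : Omega -> 'I_M) : Prop :=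
  forall i, measurable (I @^-1` [set i]) /\
            P (I @^-1` [set i]) = (M%:R^-1)%:E.

Definition independent_indices P (I : nat -> Omega -> 'I_M) : Prop :=
  forall (J : {fset nat}) (A : nat -> set 'I_M),
    P (\bigcap_(k in [set` J]) (I k @^-1` A k)) =
    \prod_(k <- J) P (I k @^-1` A k).

(* Componentwise expectation; total variation distances are at most 1, so
   [fine] is harmless. *)
Definition mean_tv_vec {X : 'I_M -> countType} P (mustar : marginals)
    (mu : Omega -> @marginals R M X) : 'cV[R]_M :=
  \col_i fine 'E_P[fun w => tv (mu w i) (mustar i)].

End RandomIndex.

Section Matrices.
Context {R : realType} {n : nat}.
Implicit Types (A : 'M[R]_n) (u v : 'cV[R]_n).

Definition le_vec u v : Prop := forall i, u i 0 <= v i 0.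

Definition lt_vec u v : Prop := forall i, u i 0 < v i 0.

Definition spectral_radius A : R :=
  sup [set ComplexField.Normc.normc z
      | z in [set z : R[i] | eigenvalue (map_mx (real_complex R) A) z]].

Definition strict_lower A : 'M[R]_n :=
  \matrix_(i, j) if (j < i)%N then A i j else 0.

Definition strict_upper A : 'M[R]_n :=
  \matrix_(i, j) if (i < j)%N then A i j else 0.

(* Exponential convergence of the error vectors [T m] to 0, with rate the
   spectral radius of [A]: the one-step bound by [A] iterates and the limsup of
   the m-th root of the norm is at most that spectral radius, which is < 1. *)
Definition exp_converges A (T : nat -> 'cV[R]_n) : Prop :=
  [/\ forall m, le_vec (T m) (A ^+ m *m T 0%N),
      (limn_esup (fun m => (mx_norm (T m) `^ m%:R^-1)%:E)
         <= (spectral_radius A)%:E)%E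
    & spectral_radius A < 1].

End Matrices.

Definition rate_mx {R : realType} {M : nat} (L : 'M[R]_M)
    (lambda : 'I_M -> R) : 'M[R]_M :=
  \matrix_(i, j) if i == j then 0 else L i j / lambda i.

(* Main.v *)
Require Import Defs.
From HB Require Import structures.
From mathcomp Require Import all_boot all_order all_algebra finmap complex.
From mathcomp Require Import all_classical all_reals all_analysis measurable_realfun.

Set Implicit Arguments.
Unset Strict Implicit.
Unset Printing Implicit Defensive.

Import Order.TTheory GRing.Theory Num.Theory numFieldNormedType.Exports.

Local Open Scope classical_set_scope.
Local Open Scope ring_scope.

(* Write R for the matrix L_ij / lambda_i. Applying the
   transportation-information inequality of mustar^i to the updated marginal
   and then Fisher-smoothness bounds the new distance of coordinate i by
   sum_j R_ij TV(mu^j, mustar^j); since R delta < delta, the balls of radii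
   c delta_i are invariant. Each scan then satisfies T' <= A T for some A >= 0
   with A delta < delta, and such a delta forces the spectral radius of A to be
   < 1 (pair a left eigenvector, taken in absolute value, with delta). The
   limsup of the m-th roots is controlled by Gelfand's bound
   |A^m| <= K r^m for r > rho(A), obtained from Cayley-Hamilton by peeling off
   the linear factors of the characteristic polynomial. For the random scan the
   iterate is a function of the index history, which is uniform on n-tuples, so
   all expectations are finite averages. *)

(** * Nonnegative matrices and the spectral radius *)

Lemma le_mulmx m n p (R : numDomainType) (A : 'M[R]_(m, n)) (u v : 'M[R]_(n, p)) :
    (forall i j, 0 <= A i j) -> (forall i j, u i j <= v i j) ->
  forall i j, (A *m u) i j <= (A *m v) i j.
Proof.
move=> A0 uv i j; rewrite !mxE; apply: ler_sum => k _.
by rewrite ler_wpM2l.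
Qed.

(** [limn_esup] is an infimum, over the neighbourhoods of infinity, of suprema of [u]; the set where
    the bound holds is itself such a neighbourhood. *)
Lemma limn_esup_le_near (R : realType) (u : (\bar R)^nat) (l : \bar R) :
  (\forall m \near \oo, (u m <= l)%E) -> (limn_esup u <= l)%E.
Proof.
move=> ul; apply: (@le_trans _ _ (ereal_sup (u @` [set m | (u m <= l)%E]))).
  by apply: ereal_inf_lbound; exists [set m | (u m <= l)%E].
by apply: ub_ereal_sup => _ [m um <-].
Qed.

(** Since [(q / r) ^+ m] tends to 0, enlarging the base absorbs any constant. *)
Lemma near_geometric_le (R : realType) (K q r : R) :
    0 <= q -> q < r ->
  \forall m \near \oo, K * q ^+ m <= r ^+ m.
Proof.
move=> q0 qr; have r0 : 0 < r by exact: le_lt_trans qr.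
have qr0 : (fun m => K * (q / r) ^+ m) @ \oo --> (K * 0 : R).
  apply: cvgMr; apply: cvg_expr.
  by rewrite ger0_norm ?divr_ge0 ?(ltW r0) // ltr_pdivrMr // mul1r.
near=> m.
have : K * (q / r) ^+ m <= 1.
  apply/ltW; near: m; apply: (cvgr_lt _ qr0); by rewrite mulr0.
by rewrite expr_div_n mulrA ler_pdivrMr ?exprn_gt0 // mul1r.
Unshelve. all: by end_near. Qed.

(* If (A - z) B obeys a bound K r^m, then A^(m+1) B = A^m (A - z) B + z A^m B
   gives the bound K' r^m for B once K <= K' (r - |z|). *)
Lemma norm_expmx_le (C : numFieldType) n (A B : 'M[C]_n.+1) (s : seq C) r :
    0 < r -> (forall z, z \in s -> `|z| < r) ->
    (\prod_(z <- s) (A - z%:M)) * B = 0 ->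
  exists2 K, 0 <= K & forall m i j, `|(A ^+ m * B) i j| <= K * r ^+ m.
Proof.
move=> r0; elim/last_ind: s B => [|s z IHs] B zr.
  rewrite big_nil mul1r => ->; exists 0 => // m i j.
  by rewrite mulr0 mxE normr0 mul0r.
rewrite big_rcons /= -mulrA => /IHs[z' z's|K K0 AK].
  by apply: zr; rewrite mem_rcons inE z's orbT.
have rz : 0 < r - `|z| by rewrite subr_gt0 zr // mem_rcons mem_head.
have BS i j : `|B i j| <= \sum_i \sum_j `|B i j|.
  rewrite (bigD1 i) //= (bigD1 j) //= -addrA lerDl addr_ge0 ?sumr_ge0 //.
  by move=> k _; rewrite sumr_ge0.
have S0 : 0 <= \sum_i \sum_j `|B i j| by exact: le_trans (BS 0 0).
have K'0 : 0 <= K / (r - `|z|) + \sum_i \sum_j `|B i j|.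
  by rewrite addr_ge0 // divr_ge0 ?(ltW rz).
(* The first summand gives K <= K' (r - |z|), which closes the induction on [m]; the second bounds
   every entry of [B], which is the case [m = 0]. *)
exists (K / (r - `|z|) + \sum_i \sum_j `|B i j|) => // m i j.
elim: m i j => [|m IHm] i j.
  rewrite !expr0 mul1r mulr1 (le_trans (BS i j)) // lerDr.
  by rewrite divr_ge0 ?(ltW rz).
have -> : A ^+ m.+1 * B = A ^+ m * ((A - z%:M) * B) + z *: (A ^+ m * B).
  rewrite exprSr mulrBl mulrBr -mulrA -[X in _ - X + _]/(A ^+ m *m (z%:M *m B)).
  by rewrite mul_scalar_mx -scalemxAr subrK.
rewrite mxE [X in `|_ + X|]mxE; apply: le_trans (ler_normD _ _) _.
rewrite normrM; apply: le_trans (lerD (AK m i j) (ler_wpM2l _ (IHm i j))) _ => //.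
rewrite mulrA -mulrDl exprS mulrA ler_wpM2r ?exprn_ge0 ?(ltW r0) //.
rewrite -lerBrDr (mulrC `|z|) -mulrBr mulrDl mulfVK ?gt_eqF //.
by rewrite lerDl mulr_ge0 // ltW.
Qed.

(** By Cayley-Hamilton the product of the [A - z%:M], over the roots [z] of the characteristic
    polynomial, vanishes, so the previous bound applies with [B = 1]. *)
Lemma norm_expmx_le_eigenvalue (C : numClosedFieldType) n (A : 'M[C]_n.+1) r :
    0 < r -> (forall z, eigenvalue A z -> `|z| < r) ->
  exists2 K, 0 <= K & forall m i j, `|(A ^+ m) i j| <= K * r ^+ m.
Proof.
move=> r0 Ar; have [s As] := closed_field_poly_normal (char_poly A).
rewrite (monicP (char_poly_monic A)) scale1r in As.
have [z zs||K K0 AK] := @norm_expmx_le _ _ A 1 s r r0.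
- by apply: Ar; rewrite eigenvalue_root_char As root_prod_XsubC.
- rewrite mulr1 -[RHS](Cayley_Hamilton A) As rmorph_prod /=.
  by apply: eq_bigr => z _; rewrite rmorphB /= horner_mx_X horner_mx_C.
- by exists K => // m i j; have := AK m i j; rewrite mulr1.
Qed.

Section SpectralRadius.
Variables (R : realType).

Local Notation normc := ComplexField.Normc.normc.

Lemma normcE (z : R[i]) : `|z| = real_complex R (normc z).
Proof. by case: z. Qed.

Lemma normc_ge0 (z : R[i]) : 0 <= normc z.
Proof. by case: z => a b; exact: sqrtr_ge0. Qed.

(* v A = z v gives |z| (|v| delta) <= |v| A delta <= theta (|v| delta). *)
Lemma eigenvalue_normc_le n (A : 'M[R]_n) (delta : 'cV[R]_n) theta z :
    (forall i j, 0 <= A i j) -> lt_vec 0 delta ->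
    le_vec (A *m delta) (theta *: delta) ->
  eigenvalue (map_mx (real_complex R) A) z -> normc z <= theta.
Proof.
move=> A0 delta0 Atheta /eigenvalueP[v vA v0].
pose w : 'rV[R]_n := \row_j normc (v 0 j).
have w0 j : 0 <= w 0 j by rewrite mxE normc_ge0.
have zw j : normc z * w 0 j <= (w *m A) 0 j.
  rewrite -lecR rmorphM /= [w 0 j]mxE -!normcE -normrM.
  have -> : z * v 0 j = (v *m map_mx (real_complex R) A) 0 j by rewrite vA mxE.
  rewrite !mxE rmorph_sum /=; apply: le_trans (ler_norm_sum _ _ _) _.
  apply: ler_sum => k _; rewrite mxE normrM rmorphM /= !mxE -!normcE ler_wpM2l //.
  by rewrite ger0_norm // ler0c.
have d0 j : 0 < delta j 0 by have := delta0 j; rewrite mxE.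
have wd : 0 < (w *m delta) 0 0.
  have [j vj] : exists j, v 0 j != 0.
    apply/existsP; apply: contraNT v0; rewrite negb_exists => /forallP v0.
    by apply/eqP/rowP => j; rewrite mxE; apply/eqP; have := v0 j; rewrite negbK.
  rewrite mxE (bigD1 j) //= ltr_wpDr //.
    by apply: sumr_ge0 => k _; rewrite mulr_ge0 // ltW.
  rewrite mulr_gt0 //.
  rewrite lt_neqAle w0 andbT mxE eq_sym; apply: contra vj => /eqP.
  by move/ComplexField.Normc.eq0_normc ->.
rewrite -(ler_pM2r wd); apply: (@le_trans _ _ ((w *m A *m delta) 0 0)).
  rewrite !mxE mulr_sumr; apply: ler_sum => j _.
  by rewrite mulrA ler_wpM2r // ltW.
have -> : theta * (w *m delta) 0 0 = (w *m (theta *: delta)) 0 0.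
  by rewrite -scalemxAr [RHS]mxE.
rewrite -mulmxA !mxE; apply: ler_sum => j _.
by rewrite ler_wpM2l //; exact: Atheta.
Qed.

(** [theta] is the largest ratio [u i 0 / delta i 0], or 0 if all are negative; finitely many
    numbers below 1 have a maximum below 1. *)
Lemma lt_vec_scale n (u delta : 'cV[R]_n) :
    lt_vec 0 delta -> lt_vec u delta ->
  exists2 theta, theta < 1 & le_vec u (theta *: delta).
Proof.
move=> delta0 ud; have d0 i : 0 < delta i 0 by have := delta0 i; rewrite mxE.
exists (\big[Order.max/0]_i (u i 0 / delta i 0)).
  by apply: bigmax_lt => // i _; rewrite ltr_pdivrMr // mul1r.
move=> i; rewrite mxE -ler_pdivrMr //.
exact: (@le_bigmax _ _ _ 0 (fun i => u i 0 / delta i 0)).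
Qed.

(** In positive dimension the characteristic polynomial is not constant. Nonemptiness makes the
    [sup] in [spectral_radius] a genuine supremum. *)
Lemma eigenvalue_set_neq0 n (A : 'M[R]_n.+1) :
  exists z, eigenvalue (map_mx (real_complex R) A) z.
Proof.
have /closed_rootP[z Az] : size (char_poly (map_mx (real_complex R) A)) != 1%N.
  by rewrite size_char_poly.
by exists z; rewrite eigenvalue_root_char.
Qed.

Lemma spectral_radius_lt1 n (A : 'M[R]_n.+1) (delta : 'cV[R]_n.+1) :
    (forall i j, 0 <= A i j) -> lt_vec 0 delta -> lt_vec (A *m delta) delta ->
  spectral_radius A < 1.
Proof.
move=> A0 delta0 /(lt_vec_scale delta0)[theta theta1 Atheta].
apply: le_lt_trans theta1; apply: ge_sup.
  by have [z Az] := eigenvalue_set_neq0 A; exists (normc z), z.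
by move=> _ [z Az <-]; exact: eigenvalue_normc_le Az.
Qed.

Lemma normc_le_spectral_radius n (A : 'M[R]_n.+1) z :
  eigenvalue (map_mx (real_complex R) A) z -> normc z <= spectral_radius A.
Proof.
move=> Az; apply: ub_le_sup; last by exists z.
have [s As] :=
  closed_field_poly_normal (char_poly (map_mx (real_complex R) A)).
rewrite (monicP (char_poly_monic _)) scale1r in As.
(* Every eigenvalue is one of the finitely many roots [s], so the sum of their moduli is an upper
   bound. *)
exists (\sum_(z <- s) normc z) => _ [y Ay <-].
have ys : y \in s.
  by move: Ay; rewrite /= eigenvalue_root_char As root_prod_XsubC.
by rewrite (big_rem y) //= lerDl sumr_ge0 // => ? _; exact: normc_ge0.
Qed.

Lemma expmx_le_spectral_radius n (A : 'M[R]_n.+1) r :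
    spectral_radius A < r ->
  exists2 K, 0 <= K & forall m i j, `|(A ^+ m) i j| <= K * r ^+ m.
Proof.
move=> Ar; have r0 : 0 < r.
  have [z /normc_le_spectral_radius Az] := eigenvalue_set_neq0 A.
  by apply: le_lt_trans Ar; apply: le_trans Az; exact: normc_ge0.
have [|z Az|K K0 AK] :=
  @norm_expmx_le_eigenvalue _ _ (map_mx (real_complex R) A) (real_complex R r).
- by rewrite ltcR.
- by rewrite normcE ltcR (le_lt_trans (normc_le_spectral_radius Az)).
(* [K] is a complex number; being nonnegative, it is real and equal to its modulus. *)
exists (normc K); first exact: normc_ge0.
move=> m i j; rewrite -lecR rmorphM rmorphXn /= -normcE (ger0_norm K0).
have := AK m i j; rewrite -rmorphXn /= mxE; apply: le_trans.
by rewrite normcE lecR /ComplexField.Normc.normc /= expr0n addr0 sqrtr_sqr.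
Qed.

Lemma mx_norm_expmx_le n (A : 'M[R]_n.+1) (v : 'cV[R]_n.+1) K q m :
    (forall i j, `|(A ^+ m) i j| <= K * q ^+ m) ->
  mx_norm (A ^+ m *m v) <= (\sum_i K * `|v i 0|) * q ^+ m.
Proof.
move=> AK; have S0 i : `|(A ^+ m *m v) i 0| <= (\sum_i K * `|v i 0|) * q ^+ m.
  rewrite mxE (le_trans (ler_norm_sum _ _ _)) // mulr_suml ler_sum // => j _.
  by rewrite normrM mulrAC ler_wpM2r.
rewrite mx_normrE; apply: bigmax_le => [|[i j] _ /=]; last by rewrite ord1.
exact: le_trans (S0 ord0).
Qed.

(** The three scans all end here, each with its own [A] but with the same positive vector. *)
Lemma exp_converges_contraction n (A : 'M[R]_n) (delta : 'cV[R]_n)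
    (T : nat -> 'cV[R]_n) :
    (0 < n)%N ->
    (forall i j, 0 <= A i j) -> lt_vec 0 delta -> lt_vec (A *m delta) delta ->
    (forall m, le_vec 0 (T m)) -> (forall m, le_vec (T m.+1) (A *m T m)) ->
  exp_converges A T.
Proof.
case: n => // n in A delta T * => _ A0 delta0 Adelta T0 TA.
have TAm m : le_vec (T m) (A ^+ m *m T 0%N).
  elim: m => [|m IHm] i; first by rewrite expr0 mul1mx.
  rewrite exprS -[A * _]/(A *m _) -mulmxA; apply: le_trans (TA m i) _.
  by apply: le_mulmx => // k l; rewrite ord1.
split=> //; last exact: spectral_radius_lt1 delta0 Adelta.
apply/lee_addgt0Pr => e e0; rewrite -EFinD.
have rho0 : 0 <= spectral_radius A.
  have [z /normc_le_spectral_radius Az] := eigenvalue_set_neq0 A.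
  by apply: le_trans Az; exact: normc_ge0.
(* Two margins above the spectral radius: Gelfand's bound holds with base [q], and the gap between
   [q] and [r] absorbs its constant. *)
set q := spectral_radius A + e / 2; set r := spectral_radius A + e.
have q0 : 0 <= q by rewrite addr_ge0 // divr_ge0 // ltW.
have r0 : 0 <= r by rewrite addr_ge0 // ltW.
have qr : q < r by rewrite ltrD2l ltr_pdivrMr // mulr_natr mulr2n ltrDl.
have [|K _ AK] := @expmx_le_spectral_radius _ A q.
  by rewrite ltrDl divr_gt0.
apply: limn_esup_le_near; near=> m.
(* At [m = 0] the exponent [m%:R^-1] is 0, so the root does not undo the power. *)
have m0 : (0 < m)%N by near: m; exists 1%N.
have Tr : mx_norm (T m) <= r ^+ m.
  apply: (@le_trans _ _ ((\sum_i K * `|T 0%N i 0|) * q ^+ m)); last first.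
    by near: m; exact: near_geometric_le.
  apply: le_trans (mx_norm_expmx_le _ (AK m)).
  rewrite !mx_normrE; apply: le_bigmax2 => -[i j] _ /=; rewrite ord1.
  have Ti := T0 m i; rewrite mxE in Ti.
  by rewrite !ger0_norm ?TAm // (le_trans Ti) // TAm.
rewrite lee_fin; apply: le_trans (_ : (r ^+ m) `^ m%:R^-1 <= _).
  by rewrite ge0_ler_powR ?invr_ge0 ?nnegrE ?exprn_ge0 // mx_normrE bigmax_ge_id.
by rewrite -powR_mulrn // -powRrM divff ?powRr1 // pnatr_eq0 -lt0n.
Unshelve. all: by end_near. Qed.

End SpectralRadius.

(** * The sequential scan matrix *)

Section StrictLower.
Variables (R : realType) (n : nat).
Implicit Types (A B : 'M[R]_n) (u v : 'cV[R]_n).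

(** Forward substitution: row [i] bounds [u i 0 - v i 0] by a nonnegative combination of the earlier
    differences, which are nonpositive by strong induction. Thus the inverse of
    [1%:M - strict_lower A] preserves the order. *)
Lemma le_vec_strict_lower A u v :
    (forall i j, 0 <= A i j) ->
    le_vec ((1%:M - strict_lower A) *m u) ((1%:M - strict_lower A) *m v) ->
  le_vec u v.
Proof.
move=> A0 Auv i; have [m] := ubnP (val i); elim: m i => // m IHm i im.
have := Auv i; rewrite !mulmxBl !mul1mx !mxE lerBlDr; move/le_trans; apply.
rewrite -addrA gerDl addrC subr_le0; apply: ler_sum => j _; rewrite mxE.
case: ifPn => [ji|]; last by rewrite !mul0r.
by rewrite ler_wpM2l // IHm // (leq_trans ji) // -ltnS.
Qed.

Lemma lt_vec_strict_lower A u v :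
    (forall i j, 0 <= A i j) ->
    lt_vec ((1%:M - strict_lower A) *m u) ((1%:M - strict_lower A) *m v) ->
  lt_vec u v.
Proof.
move=> A0 Auv i; have uv : le_vec u v.
  by apply: (@le_vec_strict_lower A) => // j; exact: ltW.
have := Auv i; rewrite !mulmxBl !mul1mx !mxE ltrBlDr; move/lt_le_trans; apply.
rewrite -addrA gerDl addrC subr_le0; apply: ler_sum => j _; rewrite mxE.
by case: ifPn => [ji|]; rewrite ?mul0r // ler_wpM2l // uv.
Qed.

Lemma unitmx_sub_strict_lower A : 1%:M - strict_lower A \in unitmx.
Proof.
rewrite unitmxE det_trig.
  rewrite big1 ?unitr1 // => i _.
  by rewrite !mxE eqxx ltnn subr0.
apply/is_trig_mxP => i j ij.
by rewrite !mxE -val_eqE /= (ltn_eqF ij) ltnNge (ltnW ij) subr0.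
Qed.

(** Multiplying column [j] by [1%:M - strict_lower A] gives column [j] of [strict_upper A], which is
    nonnegative; forward substitution pulls the sign back. *)
Lemma sequential_mx_ge0 A :
    (forall i j, 0 <= A i j) ->
  forall i j, 0 <= (invmx (1%:M - strict_lower A) *m strict_upper A) i j.
Proof.
move=> A0 i j; set B := _ *m _.
have : le_vec 0 (col j B).
  apply: (@le_vec_strict_lower A) => // k.
  rewrite mulmx0 colE /B -mulmxA mulKVmx ?unitmx_sub_strict_lower // -colE !mxE.
  by case: ifP.
by move/(_ i); rewrite !mxE.
Qed.

Lemma le_vec_sequential A u v :
    (forall i j, 0 <= A i j) ->
    le_vec u (strict_lower A *m u + strict_upper A *m v) ->
  le_vec u (invmx (1%:M - strict_lower A) *m strict_upper A *m v).
Proof.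
move=> A0 uv; apply: (@le_vec_strict_lower A) => // i.
rewrite -mulmxA mulKVmx ?unitmx_sub_strict_lower // mulmxBl mul1mx.
by have := uv i; rewrite !mxE lerBlDl.
Qed.

Lemma strict_split_le A u i :
    (forall i j, 0 <= A i j) -> le_vec 0 u ->
  (strict_lower A *m u) i 0 + (strict_upper A *m u) i 0 <= (A *m u) i 0.
Proof.
move=> A0 u0; rewrite !mxE -big_split /=; apply: ler_sum => j _.
have uj := u0 j; rewrite mxE in uj.
by rewrite !mxE; case: ltngtP => _; rewrite ?mul0r ?addr0 ?add0r // mulr_ge0.
Qed.

(** After multiplication by [1%:M - strict_lower A], it remains to see that the two triangular parts
    applied to [u] sum to less than [u]; compared with [A *m u] they omit only nonnegative diagonal
    terms. *)
Lemma lt_vec_sequential A u :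
    (forall i j, 0 <= A i j) -> le_vec 0 u -> lt_vec (A *m u) u ->
  lt_vec (invmx (1%:M - strict_lower A) *m strict_upper A *m u) u.
Proof.
move=> A0 u0 Au; apply: (@lt_vec_strict_lower A) => // i.
rewrite -mulmxA mulKVmx ?unitmx_sub_strict_lower // mulmxBl mul1mx.
rewrite [ltRHS]mxE [X in _ + X]mxE ltrBrDl.
exact: le_lt_trans (strict_split_le i A0 u0) (Au i).
Qed.

End StrictLower.

(** * Optimality maps *)

Lemma tv_ge0 (R : realType) (T : countType) (p q : T -> R) : 0 <= tv p q.
Proof.
rewrite /tv mulr_ge0 ?invr_ge0 //; apply: fine_ge0; apply: esum_ge0 => x _.
by rewrite lee_fin.
Qed.

Lemma ge0_esumZl (R : realType) (T : choiceType) (S : set T) (a : T -> \bar R)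
    (r : R) :
    (forall x, 0 <= a x)%E -> 0 < r ->
  (\esum_(x in S) (r%:E * a x) = r%:E * \esum_(x in S) a x)%E.
Proof.
move=> a0 r0; rewrite /esum -ereal_sup_pZl // image_comp.
congr ereal_sup; apply: eq_imagel => A _ /=.
by rewrite ge0_mule_fsumr.
Qed.

Lemma opt_map_pmf (R : realType) (M : nat) (X : 'I_M -> countType)
    (f : @config M X -> \bar R) i (mu : @marginals R M X) :
  opt_defined f i mu -> is_pmf (@opt_map _ _ _ f i mu).
Proof.
move=> [mass_gt0 mass_fin].
have w0 (x : X i) : (0 <= opt_weight f mu x)%E by exact: expeR_ge0.
have massE : opt_mass f i mu = (fine (opt_mass f i mu))%:E.
  by rewrite fineK // ge0_fin_numE // ltW.
have fmass0 : 0 < fine (opt_mass f i mu).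
  by rewrite fine_gt0 // mass_gt0.
(* Each weight is one term of the finite total mass, hence finite, so [fine] discards nothing. *)
have wE (x : X i) : opt_weight f mu x = (fine (opt_weight f mu x))%:E.
  rewrite fineK // ge0_fin_numE //; apply: le_lt_trans mass_fin.
  rewrite -(esum_set1 (w0 x)) /opt_mass [leRHS](esumID [set x]) //.
  by rewrite setTI leeDl // esum_ge0.
split=> [x|].
  by rewrite divr_ge0 ?fine_ge0 // ltW.
rewrite (eq_esum (b := fun x =>
  ((fine (opt_mass f i mu))^-1%:E * opt_weight f mu x)%E)); last first.
  by move=> x _; rewrite [in RHS]wE -EFinM mulrC.
rewrite ge0_esumZl ?invr_gt0 // -/(opt_mass f i mu) massE -EFinM.
by rewrite mulVf // gt_eqF.
Qed.

Lemma opt_map_tv_le (R : realType) (M : nat) (X : 'I_M -> countType)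
    (f : @config M X -> \bar R) (mustar : @marginals R M X) (eps L : 'I_M -> R)
    (lambda : R) i (mu : @marginals R M X) :
    is_opt f i mustar mustar -> fisher_smooth f mustar eps L i ->
    transport_information lambda (mustar i) ->
    (forall j, j != i -> tv_ball (eps j) (mustar j) (mu j)) ->
    opt_defined f i mu ->
  tv (opt_map f mu) (mustar i)
    <= \sum_(j | j != i) L j / lambda * tv (mu j) (mustar j).
Proof.
move=> [_ starE] [_ smooth] [lambda0 ti] mu_eps mu_def.
(* As [mustar] is a fixed point, the reference measure in the smoothness bound becomes [mustar i],
   the one in the transportation inequality. *)
have [dom osc_le] := smooth mu mu_eps mu_def; rewrite -starE in dom osc_le.
have := le_trans (ti _ (opt_map_pmf mu_def) dom) osc_le.
rewrite lee_fin -ler_pdivlMl // => /le_trans; apply.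
by rewrite mulr_sumr; apply: ler_sum => j _; rewrite mulrA (mulrC _^-1).
Qed.

(** * Expectations over index histories *)

(** [y (J w)] is the sum of the [y s] times the indicators of the fibres of [J], so measurable
    fibres suffice and [F] carries no sigma-algebra. *)
Lemma expectation_finite (R : realType) (d : measure_display)
    (Omega : measurableType d) (P : probability Omega R) (F : finType)
    (J : Omega -> F) (p y : F -> R) :
    (forall s, measurable (J @^-1` [set s])) ->
    (forall s, P (J @^-1` [set s]) = (p s)%:E) -> (forall s, 0 <= y s) ->
  ('E_P[fun w => y (J w)] = (\sum_s p s * y s)%:E)%E.
Proof.
move=> mJ PJ y0; rewrite unlock.
have m1 s : measurable_fun [set: Omega] (EFin \o \1_(J @^-1` [set s]) : Omega -> \bar R).
  exact/measurable_EFinP/measurable_indic.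
transitivity (\int[P]_w (\sum_s (y s)%:E * (\1_(J @^-1` [set s]) w)%:E))%E.
  apply: eq_integral => w _; rewrite (bigD1 (J w)) //= big1.
    by rewrite indicE mem_set // mule1 adde0.
  by move=> s sJ; rewrite indicE memNset ?mule0 // => /= Jw; rewrite Jw eqxx in sJ.
rewrite ge0_integral_sum //=; last 2 first.
- by move=> s; exact: (measurable_funeM (y s)%:E (m1 s)).
- by move=> s w _; rewrite mule_ge0 // lee_fin.
rewrite -sumEFin; apply: eq_bigr => s _.
rewrite (ge0_integralZl P measurableT (m1 s)) ?lee_fin //; last first.
  by move=> w _; rewrite lee_fin.
rewrite (_ : (\int[P]_w _)%E = (p s)%:E) 1?mulrC //.
by rewrite integral_indic // setIT; exact: PJ.
Qed.

(** A value of positive probability must be taken. A random-scan step asserts [opt_defined] only at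
    the drawn index; this extends it to every index. *)
Lemma uniform_index_witness (R : realType) (d : measure_display)
    (Omega : measurableType d) M (P : probability Omega R) (I : Omega -> 'I_M) :
  (0 < M)%N -> uniform_index P I -> forall i, exists w, I w = i.
Proof.
move=> M0 I_unif i; apply: contrapT => /forallNP i_empty.
have [_] := I_unif i; have -> : I @^-1` [set i] = set0.
  by apply/seteqP; split=> // w /= /i_empty.
rewrite measure0 => -[] /esym /eqP.
by rewrite invr_eq0 pnatr_eq0 (gtn_eqF M0).
Qed.

Section History.
Context {R : realType} {d : measure_display} {Omega : measurableType d}.
Context {M : nat} (P : probability Omega R) (I : nat -> Omega -> 'I_M).
Hypothesis M_gt0 : (0 < M)%N.
Hypothesis I_unif : forall n, uniform_index P (I n).
Hypothesis I_ind : independent_indices P I.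

Definition history n w : n.-tuple 'I_M :=
  map_tuple (fun k => I k w) (iota_tuple n 0).

Lemma historyS n w : history n.+1 w = rcons_tuple (history n w) (I n w).
Proof.
apply: val_inj; rewrite -[LHS]/(map _ (iota 0 n.+1)).
have -> : iota 0 n.+1 = rcons (iota 0 n) n by rewrite -addn1 iotaD cats1.
by rewrite map_rcons.
Qed.

(** Brings the event into the shape of [independent_indices], an intersection over a finite set of
    times. [Ordinal M_gt0] is only the default of [nth], never reached for [k < n]. *)
Lemma history_preimage n (s : n.-tuple 'I_M) :
  history n @^-1` [set s] =
  \bigcap_(k in [set` seq_fset tt (iota 0 n)])
     (I k @^-1` [set nth (Ordinal M_gt0) s k]).
Proof.
have memJ k : (k \in seq_fset tt (iota 0 n)) = (k < n)%N.
  by rewrite seq_fsetE mem_iota.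
apply/seteqP; split=> w.
  move=> <- k kJ; have kn : (k < n)%N by rewrite -memJ.
  by rewrite /= (nth_map 0%N) ?size_iota // nth_iota.
move=> Iw; apply/val_inj/(@eq_from_nth _ (Ordinal M_gt0)) => [|k].
  by rewrite !size_tuple.
rewrite size_tuple => kn; rewrite (nth_map 0%N) ?size_iota // nth_iota //.
by apply: Iw; rewrite -memJ in kn.
Qed.

Lemma history_measurable n (s : n.-tuple 'I_M) :
  measurable (history n @^-1` [set s]).
Proof.
rewrite history_preimage; apply: fin_bigcap_measurable => // k _.
by have [] := I_unif k (nth (Ordinal M_gt0) s k).
Qed.

Lemma history_uniform n (s : n.-tuple 'I_M) :
  P (history n @^-1` [set s]) = (M%:R^-1 ^+ n)%:E.
Proof.
rewrite history_preimage.
have := I_ind (seq_fset tt (iota 0 n)) (fun k => [set nth (Ordinal M_gt0) s k]).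
move=> ->; rewrite (eq_bigr (fun=> (M%:R^-1)%:E)) => [|k _]; last first.
  by have [_ ->] := I_unif k (nth (Ordinal M_gt0) s k).
have EFin_prod (x : R) (t : seq nat) : (\prod_(k <- t) x%:E = (x ^+ size t)%:E)%E.
  by elim: t => [|k t IHt]; rewrite ?big_nil // big_cons IHt exprS EFinM.
by rewrite EFin_prod size_seq_fset undup_id ?iota_uniq // size_iota.
Qed.

Lemma history_witness n (s : n.-tuple 'I_M) : exists w, history n w = s.
Proof.
apply: contrapT => /forallNP s_empty.
have := history_uniform s; have -> : history n @^-1` [set s] = set0.
  by apply/seteqP; split=> // w /= /s_empty.
rewrite measure0 => -[] /esym /eqP; rewrite expf_eq0 invr_eq0 pnatr_eq0.
by rewrite (gtn_eqF M_gt0) andbF.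
Qed.

Lemma expectation_history n (y : n.-tuple 'I_M -> R) :
    (forall s, 0 <= y s) ->
  ('E_P[fun w => y (history n w)] = (\sum_s M%:R^-1 ^+ n * y s)%:E)%E.
Proof.
move=> y0; apply: (@expectation_finite _ _ _ _ _ (history n)) => // s.
  exact: history_measurable.
exact: history_uniform.
Qed.

(** Keeping the last draw [i] apart from the past [s] lets the inner sum be compared with a one-step
    average for each past. *)
Lemma expectation_historyS n (y : n.+1.-tuple 'I_M -> R) :
    (forall s, 0 <= y s) ->
  ('E_P[fun w => y (history n.+1 w)]
   = (\sum_(s : n.-tuple 'I_M) \sum_i M%:R^-1 ^+ n.+1 * y (rcons_tuple s i))%:E)%E.
Proof.
move=> y0; rewrite pair_bigA /=.
pose J w := (history n w, I n w).
have JE u : J @^-1` [set u] = history n.+1 @^-1` [set rcons_tuple u.1 u.2].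
  apply/seteqP; split=> w; rewrite /= historyS; first by move=> <-.
  move/(congr1 val)/rcons_inj => [Js Ji].
  by case: u Js Ji => s i /= Js Ji; congr pair => //; exact: val_inj.
rewrite (eq_fun (_ : _ =1 (fun w => y (rcons_tuple (J w).1 (J w).2)))); last first.
  by move=> w; rewrite historyS.
apply: (@expectation_finite _ _ _ _ _ J (fun=> M%:R^-1 ^+ n.+1)
  (fun u => y (rcons_tuple u.1 u.2))) => // u; rewrite JE.
  exact: history_measurable.
exact: history_uniform.
Qed.

End History.

(** * One-step contraction of the scans *)

Section ContractiveScans.
Context {R : realType} {M : nat} {X : 'I_M -> countType}.
Context (f : @config M X -> \bar R) (mustar : @marginals R M X).
Arguments mustar : clear implicits.
Variables (A : 'M[R]_M) (r : 'cV[R]_M).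
Implicit Types (mu nu : @marginals R M X) (i j : 'I_M).

Local Notation T := (tv_vec mustar).
Local Notation B := (in_balls mustar r).

Hypothesis A_ge0 : forall i j, 0 <= A i j.
Hypothesis A_r : lt_vec (A *m r) r.
Hypothesis optP : forall i nu,
  (forall j, j != i -> tv_ball (r j 0) (mustar j) (nu j)) ->
  opt_defined f i nu ->
  is_pmf (opt_map f (i := i) nu) /\
  tv (opt_map f (i := i) nu) (mustar i)
    <= \sum_(j | j != i) A i j * tv (nu j) (mustar j).

Lemma tv_vec_ge0 mu : le_vec 0 (T mu).
Proof. by move=> i; rewrite !mxE tv_ge0. Qed.

(** Replacing distances by radii and adding the nonnegative diagonal term gives row [i] of [A *m r].
    Strictness comes from [A_r], so it holds even when the sum is empty. *)
Lemma opt_map_ball i nu :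
    (forall j, j != i -> tv_ball (r j 0) (mustar j) (nu j)) ->
    (0 <= r i 0) -> opt_defined f i nu ->
  tv_ball (r i 0) (mustar i) (opt_map f nu).
Proof.
move=> nuB ri nu_def; have [pmf tv_le] := optP nuB nu_def; split=> //.
apply: le_lt_trans tv_le _; apply: le_lt_trans (A_r i); rewrite mxE [leRHS](bigD1 i) //=.
rewrite ler_wpDl ?mulr_ge0 //; apply: ler_sum => j ji.
by rewrite ler_wpM2l // ltW //; have [] := nuB j ji.
Qed.

Lemma in_balls_ge0 mu : B mu -> forall i, 0 <= r i 0.
Proof. by move=> muB i; have [_ /ltW] := muB i; apply: le_trans; exact: tv_ge0. Qed.

Lemma opt_map_tv_le_mulmx i mu :
  B mu -> opt_defined f i mu ->
  tv (opt_map f (i := i) mu) (mustar i) <= (A *m T mu) i 0.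
Proof.
move=> muB mu_def; have [_] := optP (fun j _ => muB j) mu_def; move/le_trans.
apply; rewrite mxE [leRHS](bigD1 i) //= mxE.
have Aii : 0 <= A i i * tv (mu i) (mustar i) by rewrite mulr_ge0 // tv_ge0.
apply: ler_wpDl Aii _.
by apply: ler_sum => j _; rewrite mxE.
Qed.

Lemma parallel_step_contraction mu mu' :
  B mu -> parallel_step f mu mu' -> le_vec (T mu') (A *m T mu) /\ B mu'.
Proof.
move=> muB step; split=> i; have [mu_def mu'E] := step i; rewrite ?mxE mu'E.
  by have := opt_map_tv_le_mulmx muB mu_def; rewrite mxE.
by apply: opt_map_ball => //; exact: in_balls_ge0 muB i.
Qed.

Lemma splice_balls i mu mu' :
    B mu -> (forall j, (j < i)%N -> tv_ball (r j 0) (mustar j) (mu' j)) ->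
  B (splice i mu' mu).
Proof. by move=> muB mu'B j; rewrite /splice; case: ifPn => // /mu'B. Qed.

(** Strong induction on the coordinate: the tuple spliced at [i] takes from [mu'] only coordinates
    below [i], already known to lie in their balls. *)
Lemma sequential_step_balls mu mu' :
  B mu -> sequential_step f mu mu' -> B mu'.
Proof.
move=> muB step i; have [m] := ubnP (val i); elim: m i => // m IHm i im.
have [mu_def ->] := step i; apply: opt_map_ball mu_def.
  move=> j _; apply: splice_balls => // k ki; apply: IHm.
  by rewrite (leq_trans ki) // -ltnS.
exact: in_balls_ge0 muB i.
Qed.

Lemma sequential_step_contraction mu mu' :
    B mu -> sequential_step f mu mu' ->
  le_vec (T mu') (invmx (1%:M - strict_lower A) *m strict_upper A *m T mu).
Proof.
move=> muB step; apply: le_vec_sequential => // i.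
have [mu_def mu'E] := step i.
have mu'B := sequential_step_balls muB step.
have [_ /le_trans] := optP (fun j _ => splice_balls muB (fun k _ => mu'B k) j) mu_def.
(* Terms with [j < i] see the updated [mu'] and form [strict_lower A]; terms with [j > i] see the
   old [mu] and form [strict_upper A]. *)
rewrite mxE mu'E; apply; rewrite big_mkcond [leRHS]mxE !(mxE _ _ i 0) -big_split /=.
apply: ler_sum => j _; rewrite !mxE /splice -val_eqE.
by case: (ltngtP (val j) (val i)) => /= _; rewrite ?mul0r ?addr0 ?add0r.
Qed.

Definition random_scan_update i mu : marginals :=
  fun j => if j == i then opt_map f mu else mu j.
Arguments random_scan_update i mu : clear implicits.

Lemma random_scan_stepE i mu mu' :
  random_scan_step f i mu mu' -> mu' = random_scan_update i mu.
Proof.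
move=> [[_ mu'i] mu'j]; apply: functional_extensionality_dep => j.
by rewrite /random_scan_update; case: eqVneq => [->//|/mu'j].
Qed.

Lemma random_scan_balls i mu mu' :
  B mu -> random_scan_step f i mu mu' -> B mu'.
Proof.
move=> muB [[mu_def mu'i] mu'j] j; have [->|/mu'j->//] := eqVneq j i.
rewrite mu'i; apply: opt_map_ball => //; exact: in_balls_ge0 muB i.
Qed.

(** Of the [M] possible indices, exactly one updates coordinate [j]; the other [M - 1] leave its
    distance unchanged. *)
Lemma random_scan_average mu :
    (0 < M)%N -> B mu -> (forall i, opt_defined f i mu) ->
  le_vec (M%:R^-1 *: \sum_i T (random_scan_update i mu))
    ((M%:R^-1 *: A + ((M%:R - 1) / M%:R) *: 1%:M) *m T mu).
Proof.
move=> M0 muB mu_def j; have M0' : 0 <= M%:R^-1 :> R by rewrite invr_ge0.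
rewrite mulmxDl -!scalemxAl mul1mx [(_ - 1) / _]mulrC -scalerA -scalerDr.
rewrite [leLHS]mxE [leRHS]mxE ler_wpM2l // [leRHS]mxE summxE (bigD1 j) //=.
apply: lerD.
  by rewrite mxE /random_scan_update eqxx; exact: opt_map_tv_le_mulmx.
rewrite (eq_bigr (fun _ => T mu j 0)) => [|i ij]; last first.
  by rewrite !mxE /random_scan_update eq_sym (negPf ij).
rewrite sumr_const cardC1 card_ord [leRHS]mxE.
by rewrite -[leLHS]mulr_natl -subn1 natrB.
Qed.

Let random_scan_mx : 'M[R]_M :=
  M%:R^-1 *: A + ((M%:R - 1) / M%:R) *: 1%:M.

Lemma random_scan_mean_contraction (d : measure_display)
    (Omega : measurableType d) (P : probability Omega R) (I : Omega -> 'I_M)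
    mu (mu' : Omega -> @marginals R M X) :
    (0 < M)%N -> B mu -> uniform_index P I ->
    (forall w, random_scan_step f (I w) mu (mu' w)) ->
  le_vec (mean_tv_vec P mustar mu') (random_scan_mx *m T mu).
Proof.
move=> M0 muB I_unif step.
have mu_def i : opt_defined f i mu.
  by have [w <-] := uniform_index_witness M0 I_unif i; have [[]] := step w.
move=> j; apply: le_trans (random_scan_average M0 muB mu_def j).
have -> : mu' = fun w => random_scan_update (I w) mu.
  by apply/funext => w; exact: random_scan_stepE.
rewrite mxE (expectation_finite (p := fun=> M%:R^-1)
  (y := fun i => tv (random_scan_update i mu j) (mustar j))).
- rewrite /= mxE summxE mulr_sumr; apply: ler_sum => i _.
  by rewrite mxE.
- by move=> i; have [] := I_unif i.
- by move=> i; have [] := I_unif i.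
- by move=> i; exact: tv_ge0.
Qed.

(** * Random-scan iterates and their mean errors *)

Section RandomScanProcess.
Context (d : measure_display) (Omega : measurableType d).
Context (P : probability Omega R) (I : nat -> Omega -> 'I_M).
Context (mu0 : @marginals R M X) (mu : nat -> Omega -> @marginals R M X).
Hypothesis M_gt0 : (0 < M)%N.
Hypothesis mu0B : B mu0.
Hypothesis I_unif : forall n, uniform_index P (I n).
Hypothesis I_ind : independent_indices P I.
Hypothesis mu_0 : forall w, mu 0%N w = mu0.
Hypothesis mu_step : forall n w,
  random_scan_step f (I n w) (mu n w) (mu n.+1 w).

Let scan (s : seq 'I_M) := foldl (fun nu i => random_scan_update i nu) mu0 s.
Arguments scan s : clear implicits.

Lemma random_scan_iterE n w : mu n w = scan (history I n w).
Proof.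
elim: n => [|n IHn]; first exact: mu_0.
by rewrite historyS /scan foldl_rcons -/(scan _) -IHn; exact: random_scan_stepE.
Qed.

Lemma random_scan_iter_balls n w : B (mu n w).
Proof.
elim: n => [|n IHn]; first by rewrite mu_0.
exact: random_scan_balls (mu_step n w).
Qed.

Lemma random_scan_iter_mean n j :
  mean_tv_vec P mustar (mu n) j 0 =
  \sum_(s : n.-tuple 'I_M) M%:R^-1 ^+ n * T (scan s) j 0.
Proof.
have -> : mu n = fun w => scan (history I n w).
  by apply/funext => w; exact: random_scan_iterE.
rewrite mxE (expectation_history M_gt0 I_unif I_ind
  (y := fun s => tv (scan s j) (mustar j))) /=.
  by apply: eq_bigr => s _; rewrite mxE.
by move=> s; exact: tv_ge0.
Qed.

Lemma random_scan_iter_contraction n :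
  le_vec (mean_tv_vec P mustar (mu n.+1))
    (random_scan_mx *m mean_tv_vec P mustar (mu n)).
Proof.
have -> : mean_tv_vec P mustar (mu n) =
    \sum_(s : n.-tuple 'I_M) M%:R^-1 ^+ n *: T (scan s).
  apply/colP => j; rewrite random_scan_iter_mean summxE.
  by apply: eq_bigr => s _; rewrite [RHS]mxE.
(* Every history [s] followed by any index [i] has positive probability, hence occurs for some
   outcome. There [scan s] is a true iterate, so the one-step average applies to every [s]. *)
have scanP (s : n.-tuple 'I_M) i : B (scan s) /\ opt_defined f i (scan s).
  have [w] := history_witness M_gt0 I_unif I_ind (rcons_tuple s i).
  rewrite historyS => /(congr1 val)/rcons_inj[sE iE].
  have <- : mu n w = scan s by rewrite random_scan_iterE; exact: congr1 sE.
  by split; [exact: random_scan_iter_balls | rewrite -iE; have [[]] := mu_step n w].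
move=> j; rewrite mulmx_sumr summxE.
have -> : mu n.+1 = fun w => scan (history I n.+1 w).
  by apply/funext => w; exact: random_scan_iterE.
rewrite mxE (expectation_historyS M_gt0 I_unif I_ind
  (y := fun s => tv (scan s j) (mustar j))) /=; last by move=> s; exact: tv_ge0.
apply: ler_sum => s _; rewrite -scalemxAr [leRHS]mxE.
have sB : B (scan s) by have [] := scanP s (Ordinal M_gt0).
have s_def i : opt_defined f i (scan s) by have [] := scanP s i.
have q0 : 0 <= M%:R^-1 ^+ n :> R by rewrite exprn_ge0 ?invr_ge0.
apply: le_trans (ler_wpM2l q0 (random_scan_average M_gt0 sB s_def j)).
rewrite mxE summxE mulrA -exprSr mulr_sumr.
by apply: ler_sum => i _; rewrite mxE /scan foldl_rcons.
Qed.

End RandomScanProcess.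

End ContractiveScans.

(** * The random-scan matrix and the three conclusions *)

Lemma random_scan_mx_ge0 (R : realType) n (A : 'M[R]_n) :
    (0 < n)%N -> (forall i j, 0 <= A i j) ->
  forall i j, 0 <= (n%:R^-1 *: A + ((n%:R - 1) / n%:R) *: 1%:M) i j.
Proof.
move=> n0 A0 i j; rewrite !mxE addr_ge0 ?mulr_ge0 ?invr_ge0 ?ler0n //.
by rewrite subr_ge0 ler1n.
Qed.

(** The matrix is a convex combination of [A] and the identity; the weight [n%:R^-1] of [A] is
    positive, so strictness survives. *)
Lemma lt_vec_random_scan (R : realType) n (A : 'M[R]_n) (u : 'cV[R]_n) :
    (0 < n)%N -> lt_vec (A *m u) u ->
  lt_vec ((n%:R^-1 *: A + ((n%:R - 1) / n%:R) *: 1%:M) *m u) u.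
Proof.
move=> n0 Au i; rewrite mulmxDl -!scalemxAl mul1mx mxE [X in X + _]mxE [X in _ + X]mxE.
have n0' : 0 < n%:R :> R by rewrite ltr0n.
rewrite [_ / _]mulrC -mulrA -mulrDr ltr_pdivrMl // mulrBl mul1r.
by rewrite addrCA gtrDl subr_lt0.
Qed.

Theorem theorem11 (R : realType) (M : nat) (M_gt0 : (0 < M)%N)
    (X : 'I_M -> countType)
    (pi : @config M X -> R) (f : @config M X -> \bar R)
    (pi_pmf : is_pmf pi)
    (pi_f : forall x, (pi x)%:E = expeR (- f x)%E)
    (mustar : @marginals R M X)
    (mustar_pmf : forall i, is_pmf (mustar i))
    (mustar_opt : forall i, is_opt f i mustar mustar)
    (eps : 'I_M -> R) (L : 'M[R]_M) (lambda : 'I_M -> R)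
    (smooth : forall i, fisher_smooth f mustar eps (L i) i)
    (ti : forall i, transport_information (lambda i) (mustar i))
    (rho_lt1 : spectral_radius (rate_mx L lambda) < 1)
    (delta : 'cV[R]_M) (delta_gt0 : lt_vec 0 delta)
    (R_delta : lt_vec (rate_mx L lambda *m delta) delta)
    (c : R) (c_gt0 : 0 < c)
    (c_eps : forall i, c * delta i 0 <= eps i) :
  let Rm := rate_mx L lambda in
  let T := tv_vec mustar in
  let B := in_balls mustar (c *: delta) in
  (* parallel CAVI *)
  ((forall mu mu' : @marginals R M X, B mu -> parallel_step f mu mu' ->
      le_vec (T mu') (Rm *m T mu) /\ B mu')
   /\
   (forall mu : nat -> @marginals R M X, B (mu 0%N) ->
      (forall n, parallel_step f (mu n) (mu n.+1)) ->
      exp_converges Rm (fun m => T (mu m))))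
  /\
  (* random-scan CAVI *)
  (let A := M%:R^-1 *: Rm + ((M%:R - 1) / M%:R) *: 1%:M in
   (forall (d : measure_display) (Omega : measurableType d)
      (P : probability Omega R) (I : Omega -> 'I_M)
      (mu : @marginals R M X) (mu' : Omega -> @marginals R M X),
      B mu -> uniform_index P I ->
      (forall w, random_scan_step f (I w) mu (mu' w)) ->
      le_vec (mean_tv_vec P mustar mu') (A *m T mu) /\ forall w, B (mu' w))
   /\
   (forall (d : measure_display) (Omega : measurableType d)
      (P : probability Omega R) (I : nat -> Omega -> 'I_M)
      (mu0 : @marginals R M X) (mu : nat -> Omega -> @marginals R M X),
      B mu0 -> (forall n, uniform_index P (I n)) -> independent_indices P I ->
      (forall w, mu 0%N w = mu0) ->
      (forall n w, random_scan_step f (I n w) (mu n w) (mu n.+1 w)) ->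
      exp_converges A (fun m => mean_tv_vec P mustar (mu m))))
  /\
  (* sequential CAVI *)
  (let A := invmx (1%:M - strict_lower Rm) *m strict_upper Rm in
   (forall mu mu' : @marginals R M X, B mu -> sequential_step f mu mu' ->
      le_vec (T mu') (A *m T mu) /\ B mu')
   /\
   (forall mu : nat -> @marginals R M X, B (mu 0%N) ->
      (forall n, sequential_step f (mu n) (mu n.+1)) ->
      exp_converges A (fun m => T (mu m)))).
Proof.
move=> Rm T B.
have lambda0 i : 0 < lambda i by have [] := ti i.
have A0 i j : 0 <= Rm i j.
  rewrite mxE; case: eqVneq => // ij; rewrite divr_ge0 ?(ltW (lambda0 i)) //.
  by have [L0 _] := smooth i; apply: L0; rewrite eq_sym.
(* [c *: delta] gives the radii of the invariant balls and also the positive vector that the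
   spectral estimates require. *)
have r0 : lt_vec 0 (c *: delta).
  by move=> i; have := delta_gt0 i; rewrite !mxE => ?; rewrite mulr_gt0.
have r0' : le_vec 0 (c *: delta) by move=> i; exact: ltW.
have Ar : lt_vec (Rm *m (c *: delta)) (c *: delta).
  by move=> i; rewrite -scalemxAr [ltLHS]mxE [ltRHS]mxE ltr_pM2l // R_delta.
have optP i nu :
    (forall j, j != i -> tv_ball ((c *: delta) j 0) (mustar j) (nu j)) ->
    opt_defined f i nu ->
    is_pmf (opt_map f (i := i) nu) /\
    tv (opt_map f (i := i) nu) (mustar i)
      <= \sum_(j | j != i) Rm i j * tv (nu j) (mustar j).
  move=> nuB nu_def; split; first exact: opt_map_pmf.
  (* [c_eps] places these balls inside the domain of the smoothness assumption. *)
  have nu_eps j : j != i -> tv_ball (eps j) (mustar j) (nu j).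
    move=> /nuB[pmf tv_lt]; split=> //; apply: lt_le_trans tv_lt _.
    by rewrite mxE c_eps.
  apply: le_trans (opt_map_tv_le (mustar_opt i) (smooth i) (ti i) nu_eps nu_def) _.
  by apply: ler_sum => j ji; rewrite mxE eq_sym (negPf ji).
split; last split.
- have step := parallel_step_contraction A0 Ar optP; split=> // mu mu0 mu_step.
  have muB n : B (mu n).
    by elim: n => // n IHn; have [] := step _ _ IHn (mu_step n).
  apply: (exp_converges_contraction M_gt0 A0 r0 Ar) => n.
    exact: tv_vec_ge0.
  by have [] := step _ _ (muB n) (mu_step n).
- move=> A; have A'0 := random_scan_mx_ge0 M_gt0 A0; split.
    move=> d Omega P I mu mu' muB I_unif step; split.
      exact: (random_scan_mean_contraction A0 optP M_gt0 muB I_unif step).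
    by move=> w; exact: (random_scan_balls A0 Ar optP muB (step w)).
  move=> d Omega P I mu0 mu mu0B I_unif I_ind mu_0 mu_step.
  apply: (exp_converges_contraction M_gt0 A'0 r0 (lt_vec_random_scan M_gt0 Ar)) => n.
    by move=> i; rewrite !mxE fine_ge0 // expectation_ge0 // => w; exact: tv_ge0.
  exact: (random_scan_iter_contraction A0 Ar optP M_gt0 mu0B I_unif I_ind mu_0 mu_step).
- move=> A; split=> [mu mu' muB step|mu mu0 mu_step].
    split; first exact: (sequential_step_contraction A0 Ar optP).
    exact: (sequential_step_balls A0 Ar optP muB).
  have muB n : B (mu n).
    by elim: n => // n IHn; exact: (sequential_step_balls A0 Ar optP IHn (mu_step n)).
  apply: (exp_converges_contraction M_gt0 (sequential_mx_ge0 A0) r0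
    (lt_vec_sequential A0 r0' Ar)) => n; first exact: tv_vec_ge0.
  exact: (sequential_step_contraction A0 Ar optP (muB n) (mu_step n)).
Qed.
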